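(* Let $f:\mathbb{R}^n\to\mathbb{R}$ and let $\{x_k\}$ be the iterates generated by the Full-Low Evaluation algorithm (described in the context, with constants $c\in(0,1)$, $\bar\beta>0$, $\tau\in(0,1)$). Assume: (1) $f$ is continuously differentiable and $\nabla f$ is Lipschitz continuous with constant $L>0$; (2) there is $u_g>0$, independent of $k$, such that $\|\nabla f(x_k)-g_k\|\le u_g\,\beta_k\,\|g_k\|$ for every successful Full-Eval iteration $k$; (3) there are constants $\kappa,u_p>0$ such that, for every Full-Eval iteration $k$, $\frac{(-g_k)^\top p_k}{\|g_k\|\,\|p_k\|}>\kappa$ and $\|g_k\|\le u_p\|p_k\|$; (4) $f$ is bounded from below, with lower bound $f_{low}$. Let $ns_k=|\mathcal{I}_{SF}\cap\{0,\ldots,k-1\}|$ be the number of successful Full-Eval iterations up to iteration $k$, and $$M=c\,\min\left\{\bar\beta\,\frac{\kappa}{u_p},\ \frac{2\tau\kappa^2(1-c)}{2u_gu_p+L}\right\}.$$ Then, for every $k$ with $ns_k\ge 1$, $$\min_{i=0,\ldots,k-1}\|\nabla f(x_i)\|\ \le\ (\bar\beta u_g+1)\sqrt{\frac{f(x_0)-f_{low}}{M}}\ \frac{1}{\sqrt{ns_k}}.$$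
   Context: All norms are Euclidean. The Full-Low Evaluation algorithm minimizes $f:\mathbb{R}^n\to\mathbb{R}$ from an initial iterate $x_0$. Constants independent of $k$: $c\in(0,1)$, $\gamma>0$, $\bar\beta>0$, $\tau\in(0,1)$, $\lambda\ge 1$, $\theta\in(0,1)$, an initial direct-search stepsize $\alpha_0>0$, and a positive forcing function $\rho$. Each iteration $k=0,1,2,\ldots$ has a type $t_k\in\{\text{Full-Eval},\text{Low-Eval}\}$, with $t_0=$ Full-Eval. Full-Eval iteration (line search): compute an approximate gradient $g_k\in\mathbb{R}^n$ and a direction $p_k\in\mathbb{R}^n$. Try successively $\beta=\bar\beta,\tau\bar\beta,\tau^2\bar\beta,\ldots$ until either (a) $\beta<\gamma\rho(\alpha_k)$, in which case the iteration is unsuccessful, $x_{k+1}=x_k$ and $t_{k+1}=$ Low-Eval; or (b) $\beta\ge\gamma\rho(\alpha_k)$ and $f(x_k+\beta p_k)\le f(x_k)+c\,\beta\,g_k^\top p_k$, in which case the iteration is successful, $\beta_k=\beta$, $x_{k+1}=x_k+\beta_kp_k$ and $t_{k+1}=$ Full-Eval. For each trial $\beta$, condition (a) is checked first. In both cases $\alpha_{k+1}=\alpha_k$. Low-Eval iteration (direct search): generate a finite set $D_k$ of non-zero directions. If $f(x_k+\alpha_kd_k)\le f(x_k)-\rho(\alpha_k)$ for some $d_k\in D_k$, the iteration is successful, $x_{k+1}=x_k+\alpha_kd_k$ and $\alpha_{k+1}=\lambda\alpha_k$; otherwise it is unsuccessful, $x_{k+1}=x_k$ and $\alpha_{k+1}=\theta\alpha_k$.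 In either case $t_{k+1}\in\{\text{Full-Eval},\text{Low-Eval}\}$ is chosen by an arbitrary rule. $\mathcal{I}_{SF}$ denotes the set of indices of successful Full-Eval iterations. *)

(* Defs.v *)
From HB Require Import structures.
From mathcomp Require Import all_boot all_order all_algebra.
From mathcomp Require Import all_classical all_reals all_analysis.

Set Implicit Arguments.
Unset Strict Implicit.
Unset Printing Implicit Defensive.

Import Order.TTheory GRing.Theory Num.Theory.
Import numFieldNormedType.Exports.
Local Open Scope ring_scope.

(* The library norm `|v| on 'rV[R]_n is the sup norm, hence an explicit
   Euclidean structure. The topology, and so differentiability and continuity,
   is the same for both norms. *)
Definition dotv (R : realType) (n : nat) (u v : 'rV[R]_n) : R :=
  \sum_(i < n) u 0 i * v 0 i.

Definition enorm (R : realType) (n : nat) (v : 'rV[R]_n) : R :=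
  Num.sqrt (dotv v v).

Definition grad (R : realType) (n : nat) (f : 'rV[R]_n -> R) (y : 'rV[R]_n) :
    'rV[R]_n :=
  \row_(i < n) derive f y (delta_mx 0 i).

Definition cont_differentiable (R : realType) (n : nat) (f : 'rV[R]_n -> R) :
    Prop :=
  (forall y, differentiable f y) /\ continuous (grad f).

(* The constant L refers to the Euclidean norm, unlike in L.-lipschitz. *)
Definition grad_lipschitz (R : realType) (n : nat) (L : R)
    (f : 'rV[R]_n -> R) : Prop :=
  forall y z, enorm (grad f y - grad f z) <= L * enorm (y - z).

(* The only property required of the forcing function is positivity, and only
   on positive stepsizes. Other usual requirements (monotonicity, continuity,
   rho a = o(a) at 0+) are not imposed. *)
Record fle_params (R : realType) := FLEParams {
  armijo_c : R;
  gamma : R;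
  beta_bar : R;
  tau : R;
  lambda : R;
  theta : R;
  alpha0 : R;
  rho : R -> R;
  armijo_c_itv : 0 < armijo_c < 1;
  gamma_gt0 : 0 < gamma;
  beta_bar_gt0 : 0 < beta_bar;
  tau_itv : 0 < tau < 1;
  lambda_ge1 : 1 <= lambda;
  theta_itv : 0 < theta < 1;
  alpha0_gt0 : 0 < alpha0;
  rho_gt0 : forall a, 0 < a -> 0 < rho a
}.

Inductive iter_type := FullEval | LowEval.

Definition is_full (t : iter_type) : bool :=
  if t is FullEval then true else false.

(* The data of a run, indexed by the iteration number. The values of agrad and
   dir are meaningful at Full-Eval iterations only, those of lstep (beta_k) at
   successful Full-Eval iterations only, and those of pollset (the finite set
   D_k) at Low-Eval iterations only; elsewhere they are arbitrary. *)
Record fle_trace (R : realType) (n : nat) := FLETrace {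
  iterate : nat -> 'rV[R]_n;
  stepsize : nat -> R;
  itype : nat -> iter_type;
  success : nat -> bool;
  agrad : nat -> 'rV[R]_n;
  dir : nat -> 'rV[R]_n;
  lstep : nat -> R;
  pollset : nat -> seq 'rV[R]_n
}.

Section Algorithm.
Context (R : realType) (n : nat) (P : fle_params R) (f : 'rV[R]_n -> R)
  (T : fle_trace R n).

Definition trial (j : nat) : R := beta_bar P * tau P ^+ j.

Definition too_small (k : nat) (b : R) : bool :=
  b < gamma P * rho P (stepsize T k).

Definition armijo (k : nat) (b : R) : bool :=
  f (iterate T k + b *: dir T k) <=
  f (iterate T k) + armijo_c P * b * dotv (agrad T k) (dir T k).

(* The line search stops at the first j such that trial j is too small or
   satisfies the decrease condition, the former test taking precedence. *)
Definition full_eval_step (k : nat) : Prop :=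
  stepsize T k.+1 = stepsize T k /\
  exists j : nat,
    (forall i, (i < j)%N -> ~~ too_small k (trial i) /\ ~~ armijo k (trial i))
    /\ if too_small k (trial j) then
         [/\ success T k = false,
             iterate T k.+1 = iterate T k &
             itype T k.+1 = LowEval]
       else
         [/\ armijo k (trial j),
             success T k = true,
             lstep T k = trial j,
             iterate T k.+1 = iterate T k + lstep T k *: dir T k &
             itype T k.+1 = FullEval].

Definition poll_decrease (k : nat) (d : 'rV[R]_n) : bool :=
  f (iterate T k + stepsize T k *: d) <=
  f (iterate T k) - rho P (stepsize T k).

Definition low_eval_step (k : nat) : Prop :=
  (forall d, d \in pollset T k -> d != 0) /\
  if success T k then
    stepsize T k.+1 = lambda P * stepsize T k /\
    exists d, [/\ d \in pollset T k, poll_decrease k d &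
                  iterate T k.+1 = iterate T k + stepsize T k *: d]
  else
    [/\ forall d, d \in pollset T k -> ~~ poll_decrease k d,
        iterate T k.+1 = iterate T k &
        stepsize T k.+1 = theta P * stepsize T k].

Definition fle_run : Prop :=
  [/\ itype T 0 = FullEval,
      stepsize T 0 = alpha0 P &
      forall k, match itype T k with
                | FullEval => full_eval_step k
                | LowEval => low_eval_step k
                end].

End Algorithm.

Definition successful_full (R : realType) (n : nat) (T : fle_trace R n)
    (k : nat) : bool :=
  is_full (itype T k) && success T k.

Definition ns (R : realType) (n : nat) (T : fle_trace R n) (k : nat) : nat :=
  #|[set i : 'I_k | successful_full T i]|.

(* The minimum over i = 0, ..., k-1. For k >= 1 the default value u 0 is one of
   the terms. *)
Definition min_below (R : realType) (u : nat -> R) (k : nat) : R :=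
  \big[Order.min/u 0]_(i < k) u i.

(* Main.v *)
Require Import Defs.
From mathcomp Require Import all_boot all_order all_algebra.
From mathcomp Require Import all_classical all_reals all_analysis.
From mathcomp Require Import ring lra.

(** Every successful Full-Eval iteration decreases [f] by at least
    [M |g_k|^2], and no iteration increases [f]. Since [f] is bounded below,
    only a bounded total decrease is available, so among [ns_k] such iterations
    one must have [|g_k|^2] at most [(f x_0 - f_low) / (M ns_k)].

    For the decrease, the Armijo test and the angle condition give
    [f x_k - f x_{k+1} >= c beta_k kappa |g_k| |p_k|], so what is needed is a
    lower bound on [beta_k |p_k|] proportional to [|g_k|]. If the first trial
    step [beta_bar] is accepted, [|g_k| <= u_p |p_k|] is enough
    ([step_lower_bound]). Otherwise the previous trial [b = beta_k / tau]
    failed the Armijo test; compared with the quadratic upper bound for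
    functions with a Lipschitz gradient ([descent_lemma]), this failure forces
    [b |p_k|] to be at least a multiple of [|g_k|]
    ([rejected_step_lower_bound]). The error of [g_k] is proportional to the
    step itself, so it merely adds to the quadratic term [L / 2].

    The decreases telescope ([sum_successful_full_le]), and the true gradient
    is at most [beta_bar u_g + 1] times [g_k] ([grad_le_agrad]), which gives
    the rate after taking square roots. *)

Set Implicit Arguments.
Unset Strict Implicit.
Unset Printing Implicit Defensive.

Import Order.TTheory GRing.Theory Num.Theory.
Import numFieldNormedType.Exports.
Local Open Scope ring_scope.

(** * The Euclidean inner product *)

Section Euclidean.
Context (R : realType) (n : nat).
Implicit Types (u v w : 'rV[R]_n) (a : R).

Lemma dotvC u v : dotv u v = dotv v u.
Proof. by apply: eq_bigr => i _; rewrite mulrC. Qed.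

Lemma dotvDl u v w : dotv (u + v) w = dotv u w + dotv v w.
Proof. by rewrite -big_split; apply: eq_bigr => i _; rewrite mxE mulrDl. Qed.

Lemma dotvZl a u v : dotv (a *: u) v = a * dotv u v.
Proof. by rewrite /dotv mulr_sumr; apply: eq_bigr => i _; rewrite mxE mulrA. Qed.

Lemma dotvNl u v : dotv (- u) v = - dotv u v.
Proof. by rewrite -scaleN1r dotvZl mulN1r. Qed.

Lemma dotvBl u v w : dotv (u - v) w = dotv u w - dotv v w.
Proof. by rewrite dotvDl dotvNl. Qed.

Lemma dotvDr u v w : dotv u (v + w) = dotv u v + dotv u w.
Proof. by rewrite dotvC dotvDl !(dotvC _ u). Qed.

Lemma dotvZr a u v : dotv u (a *: v) = a * dotv u v.
Proof. by rewrite dotvC dotvZl dotvC. Qed.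

Lemma dotvv_ge0 u : 0 <= dotv u u.
Proof. by apply: sumr_ge0 => i _; exact: sqr_ge0. Qed.

Lemma enorm_ge0 u : 0 <= enorm u.
Proof. exact: sqrtr_ge0. Qed.

Lemma enorm_sqr u : enorm u ^+ 2 = dotv u u.
Proof. by rewrite sqr_sqrtr // dotvv_ge0. Qed.

Lemma enormZ a u : enorm (a *: u) = `|a| * enorm u.
Proof.
by rewrite /enorm dotvZl dotvZr mulrA -expr2 sqrtrM ?sqr_ge0 // sqrtr_sqr.
Qed.

(** If [v] is nonzero, [dotv] of [|v|^2 u - <u, v> v] with itself is
    nonnegative and equals [|v|^2 (|u|^2 |v|^2 - <u, v>^2)]. *)
Lemma dotv_sqr_le u v : dotv u v ^+ 2 <= dotv u u * dotv v v.
Proof.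
have := dotvv_ge0 v; rewrite le_eqVlt => /predU1P[v0|v_gt0].
  (* A null vector vanishes coordinatewise, hence so does the product. *)
  suff -> : dotv u v = 0 by rewrite expr0n -v0 mulr0.
  apply: big1 => i _; suff /eqP-> : v 0 i == 0 by rewrite mulr0.
  have /(_ i isT) := (psumr_eq0P (fun i _ => sqr_ge0 (v 0 i)) (esym v0)).
  by move=> /eqP; rewrite sqrf_eq0.
set w := dotv v v *: u + (- dotv u v) *: v.
have : dotv w w = dotv v v * (dotv u u * dotv v v - dotv u v ^+ 2).
  by rewrite /w !dotvDl !dotvDr !dotvZl !dotvZr (dotvC v u); ring.
by move=> ww; rewrite -subr_ge0 -(pmulr_rge0 _ v_gt0) -ww dotvv_ge0.
Qed.

Lemma dotv_le u v : dotv u v <= enorm u * enorm v.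
Proof.
apply: (le_trans (ler_norm _)); rewrite -sqrtr_sqr /enorm -sqrtrM ?dotvv_ge0 //.
by rewrite ler_wsqrtr // dotv_sqr_le.
Qed.

Lemma enormD u v : enorm (u + v) <= enorm u + enorm v.
Proof.
rewrite -(@ler_pXn2r _ 2) ?nnegrE ?addr_ge0 ?enorm_ge0 //.
rewrite enorm_sqr sqrrD !enorm_sqr dotvDl !dotvDr (dotvC v u).
have := dotv_le u v; lra.
Qed.

End Euclidean.

(** * The descent lemma *)

Section Descent.
Context (R : realType) (n : nat) (f : 'rV[R]_n -> R).

Lemma derive_grad y v : differentiable f y -> 'D_v f y = dotv (grad f y) v.
Proof.
move=> df; rewrite deriveE // [in LHS](row_sum_delta v) linear_sum.
by apply: eq_bigr => i _; rewrite linearZ /= mxE deriveE // mulrC.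
Qed.

Lemma is_derive_along_line y v t : differentiable f (y + t *: v) ->
  is_derive t (1 : R) (fun s : R => f (y + s *: v))
    (dotv (grad f (y + t *: v)) v).
Proof.
move=> df; rewrite -derive_grad //.
(* Moving [s] by [h] along the line moves the point by [h *: v]: the two
   difference quotients are the same function of [h]. *)
have quotientE : (fun h : R =>
    h^-1 *: (((fun s : R => f (y + s *: v)) \o shift t) (h *: (1 : R)) -
      f (y + t *: v))) =
  (fun h : R => h^-1 *: ((f \o shift (y + t *: v)) (h *: v) - f (y + t *: v))).
  by apply/funext => h /=; rewrite [h *: 1]mulr1 scalerDl addrCA.
have dv : derivable f (y + t *: v) v := @diff_derivable _ _ _ _ _ _ df.
by split; rewrite /derivable /derive quotientE.
Qed.

(** The mean value theorem is applied to the difference of the two sides along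
    the segment: at [c] its derivative is
    [<grad f (y + c v) - grad f y, v> - L c |v|^2], which is nonpositive by
    Cauchy-Schwarz and the Lipschitz bound. *)
Lemma descent_lemma (L : R) y v :
  (forall z, differentiable f z) -> grad_lipschitz L f ->
  f (y + v) <= f y + dotv (grad f y) v + L / 2 * enorm v ^+ 2.
Proof.
move=> df lip.
pose a := dotv (grad f y) v; pose b := L / 2 * enorm v ^+ 2.
pose h : R -> R := fun t => f (y + t *: v) - (a * t + b * t ^+ 2).
pose dh : R -> R := fun t => dotv (grad f (y + t *: v)) v - (a + b * (2 * t)).
have hder t : is_derive t (1 : R) h (dh t).
  have d1 := is_derive_along_line (df (y + t *: v)).
  have d2 : is_derive t (1 : R) (fun t : R => a * t + b * t ^+ 2)
      (a + b * (2 * t)).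
    apply: is_derive_eq.
    by rewrite /GRing.scale /=; ring.
  exact: is_deriveB.
have hcont : {within `[0, 1], continuous h}%classic.
  apply: derivable_within_continuous => t _.
  by have [] := hder t.
have [c /itvP c01] := MVT ltr01 (fun t _ => hder t) hcont.
rewrite /h subr0 mulr1 scale1r scale0r addr0 => hE.
have c_ge0 : 0 <= c by rewrite c01.
suff : dh c <= 0 by move: hE; rewrite /a /b; lra.
have := dotv_le (grad f (y + c *: v) - grad f y) v.
have := lip (y + c *: v) y.
rewrite [y + _ - y]addrAC subrr add0r enormZ ger0_norm // dotvBl -/a => lipc cs.
have := ler_wpM2r (enorm_ge0 v) lipc.
by rewrite /dh /b; lra.
Qed.

End Descent.

(** * The run of the algorithm *)

Section Run.
Context (R : realType) (n : nat) (f : 'rV[R]_n -> R) (P : fle_params R)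
  (T : fle_trace R n) (run : fle_run P f T).

Local Notation c := (armijo_c P).
Local Notation x := (iterate T).
Local Notation g := (agrad T).
Local Notation p := (dir T).
Local Notation beta := (lstep T).

Lemma trial_itv j : 0 < trial P j <= beta_bar P.
Proof.
have bb := beta_bar_gt0 P; have /andP[tau0 tau1] := tau_itv P.
by rewrite mulr_gt0 ?exprn_gt0 //= ger_pMr // exprn_ile1 // ltW.
Qed.

(** When backtracking took place, the trial step just before the accepted one
    is [beta / tau], and it must have failed the Armijo test: this failure is
    what prevents accepted steps from being too short. *)
Lemma successful_full_step k : successful_full T k ->
  [/\ 0 < beta k <= beta_bar P,
      x k.+1 = x k + beta k *: p k,
      armijo P f T k (beta k) &
      beta k = beta_bar P \/
      exists b, [/\ 0 < b, beta k = tau P * b & ~~ armijo P f T k b]].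
Proof.
case/andP; case: run => _ _ /(_ k).
case: (itype T k) => // -[_ [j [rejected search_end]]] _ succ.
case: ifP search_end => _ []; first by rewrite succ.
move=> arm _ betaE xE _; rewrite betaE in xE *; split=> //; first exact: trial_itv.
case: j rejected {arm betaE xE} => [|j] rejected.
  by left; rewrite /trial expr0 mulr1.
right; exists (trial P j); have [_ ?] := rejected j (ltnSn j).
by split=> //; [case/andP: (trial_itv j) | rewrite /trial exprS mulrCA].
Qed.

(** The forcing function is only known to be positive on positive stepsizes. *)
Lemma stepsize_gt0 k : 0 < stepsize T k.
Proof.
case: run => _ alphaE step; elim: k => [|k IHk].
  by rewrite alphaE alpha0_gt0.
have := step k; case: (itype T k) => [[-> _] //|[_]].
case: (success T k) => [[-> _]|[_ _ ->]].
  by rewrite mulr_gt0 // (lt_le_trans ltr01) // lambda_ge1.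
by rewrite mulr_gt0 //; case/andP: (theta_itv P).
Qed.

Lemma not_successful_full_le k : ~~ successful_full T k -> f (x k.+1) <= f (x k).
Proof.
rewrite /successful_full; case: run => _ _ /(_ k).
have rho_k := rho_gt0 P (stepsize_gt0 k).
case: (itype T k) => /= [[_ [j [_]]]|[_]].
  by case: ifP => _ [] => [_ -> //|_ ->].
case: (success T k) => [[_ [d [_ decr ->]]] _|[_ -> _ _ //]].
by apply: (le_trans decr); rewrite gerBl ltW.
Qed.

(** ** Decrease at successful Full-Eval iterations *)

Context (L u_g kappa u_p : R) (L_gt0 : 0 < L) (u_g_gt0 : 0 < u_g)
  (kappa_gt0 : 0 < kappa) (u_p_gt0 : 0 < u_p)
  (f_diff : forall y, differentiable f y) (f_lip : grad_lipschitz L f)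
  (grad_err : forall k, successful_full T k ->
     enorm (grad f (x k) - g k) <= u_g * beta k * enorm (g k))
  (dir_cond : forall k, itype T k = FullEval ->
     dotv (- g k) (p k) / (enorm (g k) * enorm (p k)) > kappa
     /\ enorm (g k) <= u_p * enorm (p k)).

Local Notation step_rate := (Num.min (beta_bar P * (kappa / u_p))
  (2 * tau P * kappa ^+ 2 * (1 - c) / (2 * u_g * u_p + L))).

(** The quotient in the angle condition is [0] when its denominator vanishes,
    so a positive lower bound forces both norms to be positive. *)
Lemma full_eval_direction k : successful_full T k ->
  [/\ 0 < enorm (g k), 0 < enorm (p k),
      kappa * (enorm (g k) * enorm (p k)) < - dotv (g k) (p k) &
      enorm (g k) <= u_p * enorm (p k)].
Proof.
case/andP => full _; have : itype T k = FullEval by case: (itype T k) full.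
move=> /dir_cond; rewrite dotvNl => -[angle len].
have gp_neq0 : enorm (g k) * enorm (p k) != 0.
  apply: contraTneq angle => ->; rewrite invr0 mulr0 -leNgt; exact: ltW.
have gp_gt0 : 0 < enorm (g k) * enorm (p k).
  by rewrite lt0r gp_neq0 mulr_ge0 ?enorm_ge0.
rewrite -ltr_pdivlMr //; split=> //.
- by rewrite lt0r enorm_ge0 andbT; apply: contraNneq gp_neq0 => ->; rewrite mul0r.
- by rewrite lt0r enorm_ge0 andbT; apply: contraNneq gp_neq0 => ->; rewrite mulr0.
Qed.

(** The descent lemma bounds [f (x + b p) - f x] from above by
    [b <g, p> + b |grad f x - g| |p| + L b^2 |p|^2 / 2]. If the Armijo test
    fails this exceeds [c b <g, p>], and dividing by [b] isolates the angle
    term on one side and terms proportional to [b] on the other. The gradient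
    error is controlled by [beta = tau b], hence also by [b]. *)
Lemma rejected_step_lower_bound k b : successful_full T k -> 0 < b ->
  beta k = tau P * b -> ~~ armijo P f T k b ->
  2 * (1 - c) * kappa * enorm (g k) <= b * ((2 * u_g * u_p + L) * enorm (p k)).
Proof.
move=> sk b_gt0 betaE; rewrite -ltNge => reject.
have [G_gt0 Q_gt0 angle len] := full_eval_direction sk.
have /andP[tau0 tau1] := tau_itv P; have /andP[c0 c1] := armijo_c_itv P.
have := descent_lemma (x k) (b *: p k) f_diff f_lip.
have errb : dotv (grad f (x k) - g k) (p k) <= u_g * b * u_p * enorm (p k) ^+ 2.
  apply: (le_trans (dotv_le _ _)); rewrite expr2 mulrA ler_wpM2r ?enorm_ge0 //.
  apply: (le_trans (grad_err sk)); rewrite -(mulrA _ u_p) ler_pM ?enorm_ge0 //.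
    by rewrite betaE ltW // !mulr_gt0.
  by rewrite ler_pM2l // betaE ger_pMl // ltW.
rewrite dotvBl in errb.
rewrite enormZ gtr0_norm // dotvZr => /(lt_le_trans reject) {}reject.
have {}reject : (1 - c) * - dotv (g k) (p k) <
    b * ((u_g * u_p + L / 2) * enorm (p k) ^+ 2).
  rewrite -(ltr_pM2l b_gt0).
  move: reject (ler_wpM2l (ltW b_gt0) errb); lra.
have c1_ge0 : 0 <= 1 - c by rewrite subr_ge0 ltW.
have := le_lt_trans (ler_wpM2l c1_ge0 (ltW angle)) reject.
by rewrite -(ler_pM2r Q_gt0); lra.
Qed.

(** The two terms of the minimum are the two ways in which a line search
    succeeds: at the very first trial [beta_bar], or after a rejected one. *)
Lemma step_lower_bound k : successful_full T k ->
  step_rate * enorm (g k) <= beta k * kappa * enorm (p k).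
Proof.
move=> sk; have [G_gt0 Q_gt0 angle len] := full_eval_direction sk.
have /andP[tau0 tau1] := tau_itv P; have bb := beta_bar_gt0 P.
have [_ _ _ [betaE|[b [b_gt0 betaE reject]]]] := successful_full_step sk.
  apply: (@le_trans _ _ (beta_bar P * (kappa / u_p) * enorm (g k))).
    by rewrite ler_wpM2r ?enorm_ge0 // ge_min lexx.
  rewrite betaE -!mulrA ler_pM2l // ler_pM2l // mulrC ler_pdivrMr // mulrC.
  exact: len.
have D_gt0 : 0 < 2 * u_g * u_p + L by rewrite addr_gt0 // !mulr_gt0.
apply: (@le_trans _ _ (2 * tau P * kappa ^+ 2 * (1 - c) /
    (2 * u_g * u_p + L) * enorm (g k))).
  by rewrite ler_wpM2r ?enorm_ge0 // ge_min lexx orbT.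
rewrite mulrAC ler_pdivrMr // betaE.
have := rejected_step_lower_bound sk b_gt0 betaE reject.
have tk_gt0 : 0 < tau P * kappa by rewrite mulr_gt0.
by rewrite -(ler_pM2l tk_gt0); lra.
Qed.

(** The Armijo test and the angle condition give a decrease of at least
    [c beta kappa |g| |p|], and [beta kappa |p|] is at least of order [|g|]. *)
Lemma successful_full_decrease k : successful_full T k ->
  c * step_rate * enorm (g k) ^+ 2 <= f (x k) - f (x k.+1).
Proof.
move=> sk; have [G_gt0 Q_gt0 angle _] := full_eval_direction sk.
have [/andP[beta0 _] -> arm _] := successful_full_step sk.
have /andP[c0 c1] := armijo_c_itv P.
have cG_gt0 : 0 < c * enorm (g k) by rewrite mulr_gt0.
have cb_gt0 : 0 < c * beta k by rewrite mulr_gt0.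
have := step_lower_bound sk; rewrite -(ler_pM2l cG_gt0).
move: arm angle; rewrite /armijo -(ltr_pM2l cb_gt0).
set m := step_rate; lra.
Qed.

(** The gradient error shrinks with the step, and no step exceeds [beta_bar];
    this turns bounds on [g] into bounds on the true gradient. *)
Lemma grad_le_agrad k : successful_full T k ->
  enorm (grad f (x k)) <= (beta_bar P * u_g + 1) * enorm (g k).
Proof.
move=> sk; have [/andP[_ beta_le] _ _ _] := successful_full_step sk.
rewrite -{1}(subrK (g k) (grad f (x k))); apply: (le_trans (enormD _ _)).
rewrite mulrDl mul1r lerD2r; apply: (le_trans (grad_err sk)).
by rewrite ler_wpM2r ?enorm_ge0 // mulrC ler_wpM2r // ltW.
Qed.

(** Telescoping: every iteration keeps [f] nonincreasing, and each successful
    Full-Eval iteration pays for one term of the sum. *)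
Lemma sum_successful_full_le k :
  c * step_rate * (\sum_(i < k | successful_full T i) enorm (g i) ^+ 2)
    <= f (x 0) - f (x k).
Proof.
elim: k => [|k IHk]; first by rewrite big_ord0 mulr0 subrr.
rewrite big_mkcond big_ord_recr -big_mkcond /=.
case: ifPn => [/successful_full_decrease|/not_successful_full_le]; set m := step_rate.
  by move: IHk; rewrite -/m; lra.
by move: IHk; rewrite -/m; lra.
Qed.

Lemma decrease_rate_gt0 : 0 < c * step_rate.
Proof.
have bb := beta_bar_gt0 P; have /andP[tau0 _] := tau_itv P.
have /andP[c0 c1] := armijo_c_itv P.
rewrite mulr_gt0 // lt_min; apply/andP; split.
  by rewrite mulr_gt0 ?divr_gt0.
apply: divr_gt0; first by rewrite !mulr_gt0 ?exprn_gt0 ?subr_gt0.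
by rewrite addr_gt0 ?mulr_gt0.
Qed.

(** Each of the [ns T k] terms of the telescoped sum is at least the squared
    minimal gradient norm divided by [(beta_bar u_g + 1)^2]. *)
Lemma ns_min_grad_le k f_low : (forall y, f_low <= f y) ->
  c * step_rate * (ns T k)%:R *
    min_below (fun i => enorm (grad f (x i))) k ^+ 2
  <= (beta_bar P * u_g + 1) ^+ 2 * (f (x 0) - f_low).
Proof.
move=> f_bounded.
set mu := min_below _ k; set B := beta_bar P * u_g + 1.
have B_gt0 : 0 < B by rewrite addr_gt0 // mulr_gt0 // beta_bar_gt0.
have mu_ge0 : 0 <= mu by apply: le_bigmin => [|i _]; exact: enorm_ge0.
have mu_le (i : 'I_k) : successful_full T i ->
    mu ^+ 2 <= B ^+ 2 * enorm (g i) ^+ 2.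
  move=> si; rewrite -exprMn.
  rewrite ler_pXn2r ?nnegrE ?mulr_ge0 ?enorm_ge0 ?(ltW B_gt0) //.
  exact: le_trans (bigmin_le _ i _) (grad_le_agrad si).
have sum_le : (ns T k)%:R * mu ^+ 2 <=
    B ^+ 2 * (\sum_(i < k | successful_full T i) enorm (g i) ^+ 2).
  rewrite mulr_sumr; apply: le_trans (ler_sum _ mu_le).
  by rewrite sumr_const mulr_natl /ns cardsE.
rewrite -mulrA; apply: le_trans (ler_wpM2l (ltW decrease_rate_gt0) sum_le) _.
rewrite mulrCA ler_wpM2l ?sqr_ge0 //.
by apply: (le_trans (sum_successful_full_le k)); rewrite lerD2l lerN2.
Qed.

End Run.

(** With [M > 0] and [f x_0 - f_low >= 0], the bound of [ns_min_grad_le] may be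
    divided by [M ns_k] and square roots taken on both sides. *)
Theorem theorem3p1 (R : realType) (n : nat) (f : 'rV[R]_n -> R)
    (P : fle_params R) (T : fle_trace R n) (L u_g kappa u_p f_low : R)
    (run : fle_run P f T)
    (L_gt0 : 0 < L)
    (f_C1 : cont_differentiable f)
    (f_lip : grad_lipschitz L f)
    (u_g_gt0 : 0 < u_g)
    (grad_err : forall k : nat, successful_full T k ->
       enorm (grad f (iterate T k) - agrad T k)
         <= u_g * lstep T k * enorm (agrad T k))
    (kappa_gt0 : 0 < kappa)
    (u_p_gt0 : 0 < u_p)
    (dir_cond : forall k : nat, itype T k = FullEval ->
       dotv (- agrad T k) (dir T k) / (enorm (agrad T k) * enorm (dir T k))
         > kappa
       /\ enorm (agrad T k) <= u_p * enorm (dir T k))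
    (f_bounded : forall y, f_low <= f y) :
  let M := armijo_c P *
    Num.min (beta_bar P * (kappa / u_p))
            (2 * tau P * kappa ^+ 2 * (1 - armijo_c P)
               / (2 * u_g * u_p + L)) in
  forall k : nat, (1 <= ns T k)%N ->
    min_below (fun i => enorm (grad f (iterate T i))) k
      <= (beta_bar P * u_g + 1)
         * Num.sqrt ((f (iterate T 0) - f_low) / M)
         * (1 / Num.sqrt (ns T k)%:R).
Proof.
move=> M k ns_gt0.
have := ns_min_grad_le run L_gt0 u_g_gt0 kappa_gt0 u_p_gt0 f_C1.1 f_lip
  grad_err dir_cond k f_bounded.
have M_gt0 : 0 < M.
  exact: (decrease_rate_gt0 P L_gt0 u_g_gt0 kappa_gt0 u_p_gt0).
rewrite -/M; set mu := min_below _ k; set B := beta_bar P * u_g + 1 => mu_le.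
have B_gt0 : 0 < B by rewrite addr_gt0 // mulr_gt0 // beta_bar_gt0.
have N_gt0 : 0 < (ns T k)%:R :> R by rewrite ltr0n.
have gap_ge0 : 0 <= f (iterate T 0) - f_low by rewrite subr_ge0.
apply: le_trans (ler_norm mu) _.
rewrite mul1r -sqrtr_sqr -(gtr0_norm B_gt0) -(sqrtr_sqr B) -mulrA.
rewrite -sqrtrV ?(ltW N_gt0) // -!sqrtrM ?sqr_ge0 ?divr_ge0 ?(ltW M_gt0) //.
rewrite ler_wsqrtr //.
have -> : B ^+ 2 * ((f (iterate T 0) - f_low) / M / (ns T k)%:R) =
    B ^+ 2 * (f (iterate T 0) - f_low) / (M * (ns T k)%:R).
  by field; rewrite !gt_eqF.
by rewrite ler_pdivlMr; [rewrite mulrC | exact: mulr_gt0].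
Qed.
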